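(* Let $s\geq 1$ and $r\geq 1$ be integers, let $P_{1},\ldots,P_{r}:\mathbb{R}^{s}\to\mathbb{R}$ be polynomials with rational coefficients, let $d\geq 1$ be the maximum of the total degrees of $P_1,\ldots,P_r$, and let $k=s+r$. Let $$M=\left\{(x_{1},\ldots,x_{s},P_{1}(x_{1},\ldots,x_{s}),\ldots,P_{r}(x_{1},\ldots,x_{s}))\in\mathbb{R}^{k}: (x_{1},\ldots,x_{s})\in\mathbb{R}^{s}\right\}.$$ Then for every $\lambda\geq 1/k$, $$\Pi_{s}(\mathscr{H}^{k}_{\lambda}\cap M)\supseteq \mathscr{H}^{s}_{d\lambda+d-1}.$$
   Context: For a real number $x$, $\Vert x\Vert$ denotes the distance of $x$ to the nearest integer. For an integer $m\geq 1$ and a real parameter $\lambda>0$, $\mathscr{H}^{m}_{\lambda}$ is the set of $(\zeta_{1},\ldots,\zeta_{m})\in\mathbb{R}^{m}$ such that for every fixed $\epsilon>0$ the estimate $\max_{1\leq j\leq m}\Vert q\zeta_{j}\Vert\leq q^{-\lambda+\epsilon}$ has arbitrarily large (positive) integer solutions $q$. $\Pi_{s}:\mathbb{R}^{k}\to\mathbb{R}^{s}$ is the projection onto the first $s$ coordinates. *)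

(* Defs.v *)
From HB Require Import structures.
From mathcomp Require Import all_boot all_order all_algebra.
From mathcomp Require Import all_classical all_reals all_analysis.
(* The notations of [mpoly] conflict with those of MathComp-Analysis. *)
From mathcomp Require Import -(notations) mpoly.

Set Implicit Arguments.
Unset Strict Implicit.
Unset Printing Implicit Defensive.

Import Order.TTheory GRing.Theory Num.Theory.

Local Open Scope classical_set_scope.
Local Open Scope ring_scope.

Definition dist_int (R : realType) (x : R) : R :=
  inf [set `|x - n%:~R| | n in [set: int]].

(* The default value [0] of the iterated maximum is harmless: [dist_int] is
   nonnegative. *)
Definition simult_approx (R : realType) (m : nat) (lambda : R) :
    set 'rV[R]_m :=
  [set zeta | forall eps : R, 0 < eps -> forall N : nat,
     exists q : nat, (N < q)%N /\
       \big[Num.max/0]_(j < m) dist_int (q%:R * zeta 0 j)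
         <= q%:R `^ (- lambda + eps)].
Arguments simult_approx {R} m lambda.

(* [mmeasure mdeg p] is [1 +] the total degree of [p], and [0] for [p = 0];
   hence the zero polynomial gets degree [0] here. *)
Definition total_degree (n : nat) (p : mpoly n rat) : nat :=
  (mmeasure mdeg p).-1.

(* [mmap f v p] maps the coefficients of [p] by [f] and substitutes
   [v i] for the [i]-th variable. *)
Definition rat_poly_eval (R : realType) (n : nat) (p : mpoly n rat)
    (x : 'rV[R]_n) : R :=
  mmap (@ratr R) (fun i => x 0 i) p.

Definition poly_graph (R : realType) (s r : nat)
    (P : 'I_r -> mpoly s rat) : set 'rV[R]_(s + r) :=
  [set row_mx x (\row_j rat_poly_eval (P j) x) | x in [set: 'rV[R]_s]].
Arguments poly_graph R {s r} P.

Definition proj_first (R : realType) (s r : nat) (x : 'rV[R]_(s + r)) :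
    'rV[R]_s :=
  lsubmx x.
Arguments proj_first {R s r} x.

(* Main.v *)
Require Import Defs.
From mathcomp Require Import all_boot all_order all_algebra.
From mathcomp Require Import all_classical all_reals all_analysis.
From mathcomp Require Import -(notations) mpoly.
From mathcomp Require Import ring lra.

Set Implicit Arguments.
Unset Strict Implicit.
Unset Printing Implicit Defensive.

Import Order.TTheory GRing.Theory Num.Theory.

Local Open Scope classical_set_scope.
Local Open Scope ring_scope.

(** If [p_i / q] are simultaneous approximations of the [x_i] with common
    denominator [q] and [D] clears the denominators of the coefficients of all
    the polynomials, then the common denominator [Q = D * q ^ d] works for
    polynomials of degree at most [d]: [Q * P(p / q)] is an integer, and since
    [P] is locally Lipschitz, [|Q * P(x) - Q * P(p / q)|] is of order
    [q ^ d * q ^ (- (d * lambda + d - 1) - 1) = (q ^ d) ^ (- lambda)], up to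
    arbitrarily small changes of the exponent. As [d >= 1], the coordinate
    functions are themselves polynomials of degree at most [d]. *)

Section DistInt.
Variable R : realType.
Implicit Types (x b : R) (z : int).

Lemma dist_int_le x z : dist_int x <= `|x - z%:~R|.
Proof.
by apply: ge_inf; [exists 0 => _ [n _ <-]; exact: normr_ge0 | exists z].
Qed.

(** The strict inequality yields an integer without showing that the infimum is attained. *)
Lemma dist_int_lt x b : dist_int x < b -> exists z, `|x - z%:~R| < b.
Proof.
move=> xb; have [|_ [z _ <-] zb] := inf_lt _ xb; last by exists z.
by exists `|x - 0%:~R|; exists 0.
Qed.

End DistInt.

Section LipschitzAt.
Variables (R : realType) (I : Type) (x : I -> R).
Implicit Types F G : (I -> R) -> R.

(** One endpoint is fixed at [x], so [C] may depend on [x]. The cap [delta <= 1] keeps the class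
    closed under products, hence containing all polynomials. *)
Definition lipschitz_at F := exists2 C : R, 0 <= C &
  forall (y : I -> R) (delta : R), 0 <= delta <= 1 ->
    (forall i, `|y i - x i| <= delta) -> `|F y - F x| <= C * delta.

Lemma lipschitz_at_cst (c : R) : lipschitz_at (fun=> c).
Proof. by exists 0 => // y delta _ _; rewrite subrr normr0 mul0r. Qed.

Lemma lipschitz_at_coord i : lipschitz_at (fun y => y i).
Proof. by exists 1 => // y delta _ /(_ i); rewrite mul1r. Qed.

Lemma lipschitz_atD F G : lipschitz_at F -> lipschitz_at G ->
  lipschitz_at (fun y => F y + G y).
Proof.
move=> [C C0 FC] [D D0 GD]; exists (C + D); first exact: addr_ge0.
move=> y delta d01 yx; rewrite opprD addrACA mulrDl.
by rewrite (le_trans (ler_normD _ _))// lerD// ?FC ?GD.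
Qed.

(** In the splitting [F y * (G y - G x) + (F y - F x) * G x], the factor [F y] is bounded by
    [|F x| + C] because [delta <= 1]. *)
Lemma lipschitz_atM F G : lipschitz_at F -> lipschitz_at G ->
  lipschitz_at (fun y => F y * G y).
Proof.
move=> [C C0 FC] [D D0 GD]; exists ((`|F x| + C) * D + C * `|G x|).
  by rewrite addr_ge0// mulr_ge0// addr_ge0.
move=> y delta d01 yx; have := FC _ _ d01 yx; have := GD _ _ d01 yx.
move: d01 => /andP[d0 d1] GDy FCy.
have -> : F y * G y - F x * G x = F y * (G y - G x) + (F y - F x) * G x.
  by ring.
rewrite (le_trans (ler_normD _ _))// !normrM mulrDl lerD//; last first.
  by rewrite mulrAC ler_wpM2r.
rewrite -mulrA ler_pM// -lerBlDl (le_trans (lerB_dist _ _))//.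
by rewrite (le_trans FCy)// ler_piMr.
Qed.

Lemma lipschitz_at_sum (T : Type) (r : seq T) (F : T -> (I -> R) -> R) :
  (forall t, lipschitz_at (F t)) -> lipschitz_at (fun y => \sum_(t <- r) F t y).
Proof.
move=> lF; elim: r => [|t r IHr].
  under eq_fun do rewrite big_nil.
  exact: lipschitz_at_cst.
under eq_fun do rewrite big_cons.
exact: lipschitz_atD.
Qed.

Lemma lipschitz_at_prod (T : Type) (r : seq T) (F : T -> (I -> R) -> R) :
  (forall t, lipschitz_at (F t)) ->
  lipschitz_at (fun y => \prod_(t <- r) F t y).
Proof.
move=> lF; elim: r => [|t r IHr].
  under eq_fun do rewrite big_nil.
  exact: lipschitz_at_cst.
under eq_fun do rewrite big_cons.
exact: lipschitz_atM.
Qed.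

Lemma lipschitz_atX F k : lipschitz_at F -> lipschitz_at (fun y => F y ^+ k).
Proof.
move=> lF; elim: k => [|k IHk]; first exact: lipschitz_at_cst.
under eq_fun do rewrite exprS.
exact: lipschitz_atM.
Qed.

End LipschitzAt.

Section RationalPolynomials.
Variable R : realType.

Lemma lipschitz_at_mmap n (p : mpoly n rat) (x : 'I_n -> R) :
  lipschitz_at x (fun y => mmap (@ratr R) y p).
Proof.
apply: lipschitz_at_sum => m; apply: lipschitz_atM; first exact: lipschitz_at_cst.
apply: lipschitz_at_prod => i; apply: lipschitz_atX; exact: lipschitz_at_coord.
Qed.

(** The monomial absorbs exactly [mdeg m] factors [q], one per variable occurrence; the other
    [d - mdeg m] stay as an integer factor. *)
Lemma mmap1_clear_denominators n (m : multinom n) (d q : nat)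
    (a : 'I_n -> int) : (mdeg m <= d)%N -> (0 < q)%N ->
  q%:R ^+ d * mmap1 (fun i => (a i)%:~R / q%:R : R) m \is a Num.int.
Proof.
move=> md q0; have q0R : q%:R != 0 :> R by rewrite pnatr_eq0 -lt0n.
rewrite -(subnK md) exprD -mulrA rpredM ?rpredX ?rpred_nat// /mmap1.
rewrite mdegE -prodrXr -big_split /= rpred_prod// => i _.
by rewrite expr_div_n mulrC divfK ?expf_neq0// rpredX// intr_int.
Qed.

Lemma mmap_clear_denominators n (p : mpoly n rat) (d : nat) :
  (total_degree p <= d)%N ->
  exists2 D : nat, (0 < D)%N & forall (q : nat) (a : 'I_n -> int), (0 < q)%N ->
    (D * q ^ d)%:R * mmap (@ratr R) (fun i => (a i)%:~R / q%:R) p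
      \is a Num.int.
Proof.
move=> pd; pose den m := `|denq (mcoeff m p)|%N.
have den0 m : (0 < den m)%N by rewrite absz_gt0 denq_neq0.
exists (\prod_(m <- msupp p) den m)%N; first by rewrite prodn_gt0.
move=> q a q0; rewrite /mmap mulr_sumr big_seq rpred_sum// => m mp.
rewrite natrM natrX mulrACA rpredM//.
  rewrite (bigD1_seq m)//= natrM mulrAC rpredM ?rpred_nat//.
  rewrite /ratr /den.
  rewrite natr_absz ger0_norm ?denq_ge0// mulrC divfK ?intr_int//.
  by rewrite intr_eq0 denq_neq0.
apply: mmap1_clear_denominators => //.
(* [mmeasure] is one more than the degree, so its strict bound on [mdeg m] becomes a weak one after
   the predecessor in [total_degree]. *)
by rewrite (leq_trans _ pd)// -ltnS (leq_trans (mmeasure_mnm_lt mdeg mp))// leqSpred.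
Qed.

(** This lets a small power of [q] absorb every constant. The threshold is [K] to the power [1 / e],
    which makes sense for positive [K]. *)
Lemma powR_eventually_ge (K e : R) : 0 < e ->
  exists N : nat, forall q : nat, (N < q)%N -> K <= q%:R `^ e.
Proof.
move=> e0; have [K0|K0] := leP K 0.
  by exists 0 => q _; rewrite (le_trans K0)// powR_ge0.
exists (Num.truncn (K `^ e^-1)) => q Nq.
have Kq : K `^ e^-1 <= q%:R.
  by rewrite ltW// (lt_le_trans (truncnS_gt _))// ler_nat.
have := ge0_ler_powR (ltW e0) (powR_ge0 _ _) (ler0n _ q) Kq.
by rewrite -powRrM mulVf ?gt_eqF// powRr1// ltW.
Qed.

Lemma simult_approx_poly n m d (P : 'I_m -> mpoly n rat) (lambda : R)
    (x : 'rV[R]_n) : (0 < d)%N -> 0 < lambda ->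
    (forall j, (total_degree (P j) <= d)%N) ->
  simult_approx n (d%:R * lambda + d%:R - 1) x ->
  simult_approx m lambda (\row_j rat_poly_eval (P j) x).
Proof.
move=> d0 l0 Pd hx eps eps0 N.
have d1 : 1 <= d%:R :> R by rewrite ler1n.
have /(_ _)/cid2-/all_sig2[D D0 DP] := fun j => mmap_clear_denominators (Pd j).
have /(_ _)/cid2-/all_sig2[C C0 CP] :=
  fun j => lipschitz_at_mmap (P j) (fun i => x 0 i).
(* Constants uniform in [j]: [Dt] is a multiple of each [D j], and [Ct] bounds each [C j]. *)
pose Dt := (\prod_j D j)%N; pose Ct := \sum_j C j.
have Dt0 : (0 < Dt)%N by rewrite prodn_gt0.
have Dt0R : 0 < Dt%:R :> R by rewrite ltr0n.
have Ct0 : 0 <= Ct by rewrite sumr_ge0.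
(* One half of [eps] pays for the loss [e] in the exponent, the other for the constants. The bound
   by [lambda] makes the exponent of [b] below nonpositive, so [b <= 1]. *)
pose e := Num.min (eps / 2) lambda.
have e0 : 0 < e by rewrite lt_min divr_gt0.
have e_eps : e <= eps / 2 by rewrite ge_min lexx.
have e_l : e <= lambda by rewrite ge_min lexx orbT.
have eps20 : 0 < eps / 2 by rewrite divr_gt0.
have [N1 N1P] := powR_eventually_ge (2 * Ct * Dt%:R / Dt%:R `^ (- lambda + eps)) eps20.
(* The three summands give [q > N], [q > N1] and [q >= 2]; the last one ensures [delta <= 1]
   below. *)
have [q [Nq hq]] := hx e e0 (N + N1 + 1)%N.
have q1 : (1 < q)%N by rewrite (leq_trans _ Nq)// addn1.
have q0 : (0 < q)%N by exact: ltnW.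
have q0R : 0 < q%:R :> R by rewrite ltr0n.
set b := _ `^ _ in hq.
have b0 : 0 < b by exact: powR_gt0.
(* The factor 2 turns the weak bound by [b > 0] into the strict one that [dist_int_lt] requires. *)
have /(_ _)/cid-/all_sig[a aP] : forall i, exists z : int,
    `|q%:R * x 0 i - z%:~R| < 2 * b.
  move=> i; apply: dist_int_lt; move/bigmax_leP: hq => [_ /(_ i isT)] hi.
  by rewrite (le_lt_trans hi)// ltr_pMl// ltr1n.
pose delta := 2 * b / q%:R.
have delta01 : 0 <= delta <= 1.
  rewrite divr_ge0 ?mulr_ge0 ?(ltW b0)//= ler_pdivrMr// mul1r.
  rewrite (@le_trans _ _ 2) ?ler_nat// ler_piMr// /b -[leRHS](powRr0 q%:R).
  rewrite ler_powR ?ler1n//; nra.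
have ax i : `|(a i)%:~R / q%:R - x 0 i| <= delta.
  have -> : (a i)%:~R / q%:R - x 0 i = ((a i)%:~R - q%:R * x 0 i) / q%:R.
    by field; rewrite gt_eqF.
  by rewrite normrM [`|_^-1|]gtr0_norm ?invr_gt0// ler_pM2r ?invr_gt0// distrC ltW.
exists (Dt * q ^ d)%N; split.
  rewrite (@leq_trans q)//; first by rewrite (leq_trans _ Nq)// ltnS -addnA leq_addr.
  by rewrite -[q in (q <= _)%N]mul1n leq_mul// -[q in (q <= _)%N]expn1 leq_pexp2l.
apply/bigmax_leP; split=> [|j _]; first exact: powR_ge0.
rewrite mxE /rat_poly_eval.
have /intrP[z zE] : (Dt * q ^ d)%:R * mmap (@ratr R) (fun i => (a i)%:~R / q%:R) (P j)
    \is a Num.int.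
  rewrite /Dt (bigD1 j)//= mulnAC natrM mulrAC.
  by rewrite rpredM ?rpred_nat//; apply: DP.
rewrite (le_trans (@dist_int_le _ _ z))// -zE -mulrBr normrM ger0_norm// distrC.
have CjCt : C j <= Ct by rewrite /Ct (bigD1 j)//= lerDl sumr_ge0.
rewrite (@le_trans _ _ ((Dt * q ^ d)%:R * (Ct * delta)))//.
  rewrite ler_wpM2l//; apply: le_trans (CP j _ _ delta01 ax) _.
  by rewrite ler_wpM2r//; case/andP: delta01.
have qd0 : 0 <= q%:R ^+ d :> R by rewrite exprn_ge0.
rewrite natrM natrX powRM// -[in leRHS]powR_mulrn// -powRrM.
set E := Dt%:R `^ _ in N1P *.
have E0 : 0 < E by exact: powR_gt0.
(* Exponent count: [d - (d * lambda + d - 1) + e - 1 = - d * lambda + e]. *)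
have bE : q%:R ^+ d * b / q%:R = q%:R `^ (d%:R * (- lambda) + e).
  rewrite -powR_mulrn// -[in X in _ / X](@powRr1 _ q%:R)// /b.
  have qN r s : (r + s == 0 :> R) ==> (q%:R != 0 :> R) by rewrite (gt_eqF q0R) implybT.
  rewrite -powRN -!powRD//; congr (_ `^ _); ring.
have -> : Dt%:R * q%:R ^+ d * (Ct * delta) =
    2 * Ct * Dt%:R * q%:R `^ (d%:R * (- lambda) + e).
  by rewrite -bE /delta; ring.
have /N1P : (N1 < q)%N.
  by rewrite (leq_ltn_trans _ Nq)// -addnA addnCA leq_addr.
rewrite ler_pdivrMr// => KE.
apply: (@le_trans _ _ (q%:R `^ (eps / 2) * E * q%:R `^ (d%:R * (- lambda) + e))).
  by rewrite ler_wpM2r ?powR_ge0.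
rewrite mulrAC [leRHS]mulrC ler_wpM2r ?(ltW E0)//.
(* What remains is [eps / 2 + e <= d * eps], true since [e <= eps / 2] and [d >= 1]. *)
rewrite -powRD ?(gt_eqF q0R) ?implybT// ler_powR ?ler1n//; nra.
Qed.

End RationalPolynomials.

Theorem lemma2p1 (R : realType) (s r d k : nat)
    (P : 'I_r -> mpoly s rat)
    (hs : (1 <= s)%N) (hr : (1 <= r)%N)
    (hd : d = (\max_(j < r) total_degree (P j))%N) (hd1 : (1 <= d)%N)
    (hk : k = (s + r)%N) (lambda : R) (hlambda : k%:R^-1 <= lambda) :
  simult_approx s (d%:R * lambda + d%:R - 1) `<=`
    proj_first @` (simult_approx (s + r) lambda `&` poly_graph R P).
Proof.
have lambda0 : 0 < lambda.
  by rewrite (lt_le_trans _ hlambda)// invr_gt0 ltr0n hk addn_gt0 hs.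
move=> x hx; exists (row_mx x (\row_j rat_poly_eval (P j) x)); last first.
  exact: row_mxKl.
split; last by exists x.
pose X (i : 'I_s) : mpoly s rat := mpolyX rat (mnm1 i).
pose Q (i : 'I_(s + r)) := match fintype.split i with inl i => X i | inr j => P j end.
have -> : row_mx x (\row_j rat_poly_eval (P j) x) =
    \row_i rat_poly_eval (Q i) x.
  apply/rowP => i; rewrite !mxE /Q; case: fintype.split => [i'|j]; last by rewrite mxE.
  by rewrite /rat_poly_eval mmapX mmap1U.
apply: simult_approx_poly hx => // i; rewrite /Q; case: fintype.split => [i'|j].
  by rewrite /total_degree mmeasureX /= mdeg1.
by rewrite hd; apply: leq_bigmax.
Qed.
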